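(* For each fixed $d \geq 2$ and $n \geq 1$, $$\{\, p_{n}(F) : F \text{ is a continuous NRPD distribution function on } \mathbb{R}^d \,\} = [p^*_n, 1].$$ That is, the image of the mapping $F \mapsto p_n(F)$ on the domain of NRPD distributions on $\mathbb{R}^d$ is precisely the interval $[p^*_n, 1]$.
   Context: For $\mathbf{x}, \mathbf{y} \in \mathbb{R}^d$, write $\mathbf{x} \leq \mathbf{y}$ (equivalently $\mathbf{y} \geq \mathbf{x}$) if $x_j \leq y_j$ for all $1 \leq j \leq d$. All distribution functions $F$ on $\mathbb{R}^d$ are assumed continuous. Let $\mathbf{X}$ have distribution function $F$ and let $\mathbf{X}^{(1)}, \mathbf{X}^{(2)}, \dots$ be i.i.d. copies of $\mathbf{X}$. For $n \geq 1$, $\mathbf{X}^{(n)}$ sets a (Pareto) record if $\mathbf{X}^{(n)} \leq \mathbf{X}^{(i)}$ fails for all $1 \leq i < n$. Let $p_n(F) \equiv p_{n,d}(F)$ denote the probability that $\mathbf{X}^{(n)}$ sets a record. Let $H$ denote the distribution function of $-\mathbf{X}$, so that $H(-\mathbf{x}) = \mathbb{P}(\mathbf{X} \geq \mathbf{x})$. Given two continuous distribution functions $F$ and $\widetilde F$ on $\mathbb{R}^d$, of random vectors $\mathbf{X}$ and $\widetilde{\mathbf{X}}$, let $H$ and $\widetilde H$ be the distribution functions of $-\mathbf{X}$ and $-\widetilde{\mathbf{X}}$. Say $F$ and $\widetilde F$ are RP-equivalent if the random variables $H(-\mathbf{X})$ and $\widetilde H(-\widetilde{\mathbf{X}})$ have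 the same distribution, and say $F \leq \widetilde F$ in the RP ordering if $H(-\mathbf{X}) \geq \widetilde H(-\widetilde{\mathbf{X}})$ stochastically, i.e., $\mathbb{P}(H(-\mathbf{X}) > t) \geq \mathbb{P}(\widetilde H(-\widetilde{\mathbf{X}}) > t)$ for every $t \in \mathbb{R}$. This is a partial order on RP-equivalence classes. All continuous distribution functions on $\mathbb{R}^d$ under which the $d$ coordinates are independent lie in a single RP-equivalence class, denoted $C^*$; $p^*_n$ denotes the common value of $p_n(F)$ for $F \in C^*$ (with the same $d$). A continuous $F$ is negatively record-setting probability dependent (NRPD) if $F \geq F^*$ in the RP ordering, where $F^*$ is any element of $C^*$. *)

(* Defs.v *)
From HB Require Import structures.
From mathcomp Require Import all_boot all_order all_algebra.
From mathcomp Require Import all_classical all_reals all_analysis.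

Set Implicit Arguments.
Unset Strict Implicit.
Unset Printing Implicit Defensive.

Import Order.TTheory GRing.Theory Num.Theory.
Import numFieldNormedType.Exports.

Local Open Scope classical_set_scope.
Local Open Scope ring_scope.

(* The Borel sigma-algebra of R^d, generated by the coordinates: the same
   construction that the library uses for n.-tuple T. *)
Section measurable_rV.
Context {R : realType} {d : nat}.

Let coor : 'I_d -> 'rV[R]_d -> R := fun j x => x ord0 j.

Let rV_set0 : g_sigma_preimage coor set0.
Proof. exact: sigma_algebra0. Qed.

Let rV_setC A : g_sigma_preimage coor A -> g_sigma_preimage coor (~` A).
Proof. exact: sigma_algebraC. Qed.

Let rV_bigcup (A : _^nat) : (forall i, g_sigma_preimage coor (A i)) ->
  g_sigma_preimage coor (\bigcup_i (A i)).
Proof. exact: sigma_algebra_bigcup. Qed.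

HB.instance Definition _ := @isMeasurable.Build
  (measure_tuple_display default_measure_display) 'rV[R]_d
  (g_sigma_preimage coor) rV_set0 rV_setC rV_bigcup.

End measurable_rV.

Definition le_vec (R : realType) (d : nat) (x y : 'rV[R]_d) : Prop :=
  forall j : 'I_d, x ord0 j <= y ord0 j.

Definition df (R : realType) (d : nat) (disp : measure_display)
    (T : measurableType disp) (P : probability T R) (X : T -> 'rV[R]_d)
    (x : 'rV[R]_d) : R :=
  fine (P [set w | le_vec (X w) x]).

(* The random variable H(-X), where H is the distribution function of -X. *)
Definition H_neg (R : realType) (d : nat) (disp : measure_display)
    (T : measurableType disp) (P : probability T R) (X : T -> 'rV[R]_d)
    (w : T) : R :=
  df P (fun v => - X v) (- X w).

Definition continuous_df (R : realType) (d : nat) (F : 'rV[R]_d -> R) : Prop :=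
  continuous F /\
  exists (disp : measure_display) (T : measurableType disp)
    (P : probability T R) (X : {RV P >-> 'rV[R]_d}), F = df P X.

(* Mutual independence of the family (X i), i in D: the product rule for every
   finite subfamily, listed without repetition by s. *)
Definition mutually_independent (R : realType) (disp disp' : measure_display)
    (T : measurableType disp) (T' : measurableType disp') (P : probability T R)
    (I : eqType) (D : set I) (X : I -> T -> T') : Prop :=
  forall s : seq I, uniq s -> (forall i, i \in s -> D i) ->
  forall A : I -> set T', (forall i, measurable (A i)) ->
    P (\bigcap_(i in [set` s]) (X i @^-1` A i)) =
    (\prod_(i <- s) P (X i @^-1` A i))%E.

(* X 1, ..., X n are i.i.d. with distribution function F (the value X 0 is
   irrelevant). *)
Definition iid_copies (R : realType) (d : nat) (disp : measure_display)
    (T : measurableType disp) (P : probability T R) (n : nat)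
    (X : nat -> {RV P >-> 'rV[R]_d}) (F : 'rV[R]_d -> R) : Prop :=
  (forall i, (1 <= i <= n)%N -> df P (X i) = F) /\
  mutually_independent P [set i : nat | (1 <= i <= n)%N] X.

Definition record_event (R : realType) (d : nat) (T : Type) (n : nat)
    (X : nat -> T -> 'rV[R]_d) : set T :=
  [set w | forall i, (1 <= i < n)%N -> ~ le_vec (X n w) (X i w)].

(* p_n(F); this probability does not depend on the probability space nor on the
   copies, so that xget selects the only element of a singleton whenever F is a
   distribution function. *)
Definition record_prob (R : realType) (d : nat) (n : nat)
    (F : 'rV[R]_d -> R) : R :=
  xget 0 [set p | exists (disp : measure_display) (T : measurableType disp)
    (P : probability T R) (X : nat -> {RV P >-> 'rV[R]_d}),
    iid_copies n X F /\ p = fine (P (record_event n X))].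

Definition RP_equiv (R : realType) (d : nat) (F G : 'rV[R]_d -> R) : Prop :=
  exists (disp disp' : measure_display)
    (T : measurableType disp) (T' : measurableType disp')
    (P : probability T R) (P' : probability T' R)
    (X : {RV P >-> 'rV[R]_d}) (Y : {RV P' >-> 'rV[R]_d}),
  [/\ F = df P X, G = df P' Y &
    forall B : set R, measurable B ->
      P (H_neg P X @^-1` B) = P' (H_neg P' Y @^-1` B)].

(* F <= G: the stochastic order of H(-X) and H(-Y) is reversed. *)
Definition RP_le (R : realType) (d : nat) (F G : 'rV[R]_d -> R) : Prop :=
  exists (disp disp' : measure_display)
    (T : measurableType disp) (T' : measurableType disp')
    (P : probability T R) (P' : probability T' R)
    (X : {RV P >-> 'rV[R]_d}) (Y : {RV P' >-> 'rV[R]_d}),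
  [/\ F = df P X, G = df P' Y &
    forall t : R,
      (P' [set w | (t < H_neg P' Y w)%R] <= P [set w | (t < H_neg P X w)%R])%E].

Definition independent_coordinates (R : realType) (d : nat)
    (F : 'rV[R]_d -> R) : Prop :=
  exists (disp : measure_display) (T : measurableType disp)
    (P : probability T R) (X : {RV P >-> 'rV[R]_d}),
  F = df P X /\
  mutually_independent P [set: 'I_d] (fun j w => X w ord0 j).

(* The RP-equivalence class C*. *)
Definition Cstar (R : realType) (d : nat) (F : 'rV[R]_d -> R) : Prop :=
  continuous_df F /\
  exists G : 'rV[R]_d -> R,
    [/\ continuous_df G, independent_coordinates G & RP_equiv F G].

(* p*_n: record_prob n is constant on the nonempty class C*. *)
Definition record_prob_star (R : realType) (d n : nat) : R :=
  xget 0 [set record_prob n F | F in [set F : 'rV[R]_d -> R | Cstar F]].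

Definition NRPD (R : realType) (d : nat) (F : 'rV[R]_d -> R) : Prop :=
  continuous_df F /\
  exists Fstar : 'rV[R]_d -> R, Cstar Fstar /\ RP_le Fstar F.

(* Main.v *)
From HB Require Import structures.
Require Import Defs.
From mathcomp Require Import all_boot all_order all_algebra.
From mathcomp Require Import all_classical all_reals all_analysis.
From mathcomp Require Import measurable_realfun ring lra.
Import Order.TTheory GRing.Theory Num.Theory.
Import numFieldNormedType.Exports.
Local Open Scope classical_set_scope.
Local Open Scope ring_scope.

Set Implicit Arguments.
Unset Strict Implicit.
Unset Printing Implicit Defensive.

(** The record probability is p_n(F) = E[(1 - H(-X))^(n-1)]: given that the n-th
    observation is x, it sets a record when none of the n-1 earlier independent
    copies dominates x, and a copy dominates x with probability H(-x)
    [record_prob_expectation].  This expectation is monotone in the RP ordering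
    [RP_le_record_prob], because the tail formula compares the expectations of
    the increasing function 1 - (1 - h)^(n-1) of two stochastically ordered
    variables.  Hence p_n(F) lies in [p*_n, 1] for every NRPD F.  That p*_n is
    the common value on C* comes from the probability integral transform: for
    independent coordinates without atoms, H(-X) is a product of d independent
    uniform variables [independent_coordinates_RP_equiv, record_prob_starE].

    Conversely, every value is attained along an explicit path.  Let U be uniform
    on the cube [0,1]^d, and let X_q be U, except that the second coordinate is
    replaced by -U_0 on the event U_0 >= q [tilt], where coordinates are numbered
    from 0.  Tilting can only destroy comparabilities, so H_q(-X_q) <= H(-U)
    almost surely and X_q is NRPD [H_neg_tilt_le, NRPD_tilt].  At q = 1 the
    vector is U almost surely, which gives p*_n; at q = 0 it lives on an
    antichain, which gives 1.  Since X_q and X_q' differ only when U_0 falls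
    between q and q', the record probability is n-Lipschitz in q
    [record_prob_tilt_lipschitz], and the intermediate value theorem fills the
    interval. *)

(** * Measures on tuples and on row vectors *)

(** An identity wrapper that carries a proof of measurability, so that a bare
    function can be used where a random variable is expected. *)
Definition mfun_of d d' (T : measurableType d) (T' : measurableType d')
  (f : T -> T') (mf : measurable_fun setT f) : T -> T' := f.

HB.instance Definition _ d d' (T : measurableType d) (T' : measurableType d')
    (f : T -> T') (mf : measurable_fun setT f) :=
  isMeasurableFun.Build _ _ _ _ (mfun_of mf) mf.

Section coordinate_sigma_algebra.
Context d (rT : measurableType d) (aT : Type) (n : nat).
Variable f : 'I_n -> aT -> rT.

Lemma g_sigma_preimage_coord i (A : set rT) :
  measurable A -> g_sigma_preimage f (f i @^-1` A).
Proof.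
move=> mA; apply: sub_sigma_algebra; rewrite -bigcup_seq /=.
by exists i; [rewrite /= mem_index_enum | exists A; rewrite ?setTI].
Qed.

Lemma sub_g_sigma_preimage (S : set (set aT)) : sigma_algebra setT S ->
  (forall i A, measurable A -> S (f i @^-1` A)) -> g_sigma_preimage f `<=` S.
Proof.
move=> sS fS; apply: smallest_sub => // B; rewrite -bigcup_seq /=.
by move=> [i _ [A mA <-]]; rewrite setTI; exact: fS.
Qed.

End coordinate_sigma_algebra.

Section boxes.
Context d (T : measurableType d) (n : nat).

Definition box (A : 'I_n -> set T) : set (n.-tuple T) :=
  [set t | forall i, A i (tnth t i)].

Lemma measurable_box A : (forall i, measurable (A i)) -> measurable (box A).
Proof.
move=> mA; rewrite (_ : box A =
  \bigcap_(i in [set: 'I_n]) ((@tnth n T)^~ i @^-1` A i)).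
  apply: fin_bigcap_measurable => // i _.
  by rewrite -[X in measurable X]setTI; exact: measurable_tnth.
by apply/seteqP; split=> t /= At i; [move=> _; exact: At | exact: At i I].
Qed.

(** Boxes form a pi-system that generates the sigma-algebra of tuples, so the
    product rule on boxes identifies a joint law. *)
Lemma box_measure_unique (R : realType) (m1 m2 : probability (n.-tuple T) R) :
  (forall A, (forall i, measurable (A i)) -> m1 (box A) = m2 (box A)) ->
  forall B, measurable B -> m1 B = m2 B.
Proof.
move=> m12 B mB.
pose G := [set box A | A in [set A | forall i, measurable (A i)]].
apply: (measure_unique G (fun=> setT)) => //.
- apply/seteqP; split.
    apply: sub_g_sigma_preimage; first exact: smallest_sigma_algebra.
    move=> i A mA; apply: sub_sigma_algebra.
    exists (fun j => if j == i then A else setT).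
      by move=> j /=; case: eqP.
    apply/seteqP; split=> t /=.
      by move=> /(_ i); rewrite eqxx.
    by move=> At j; case: eqP => // ->.
  apply: smallest_sub; first exact: sigma_algebra_measurable.
  by move=> _ [A mA <-]; exact: measurable_box.
- move=> _ _ [A mA <-] [A' mA' <-].
  exists (fun i => A i `&` A' i); first by move=> i; exact: measurableI.
  apply/seteqP; split=> t /=.
    by move=> AA; split=> i; case: (AA i).
  by move=> [? ?] i; split.
- by move=> _; exists (fun=> setT) => //; apply/seteqP; split.
- by rewrite bigcup_const.
- by move=> _ [A mA <-]; exact: m12.
- by move=> _ /=; rewrite probability_setT ltry.
Qed.

End boxes.

Section row_vectors.
Context {R : realType} {d : nat}.

Lemma measurable_coord (j : 'I_d) :
  measurable_fun [set: 'rV[R]_d] (fun x : 'rV[R]_d => x ord0 j).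
Proof.
move=> _ A mA; rewrite setTI.
exact: (g_sigma_preimage_coord (f := fun j (x : 'rV[R]_d) => x ord0 j)).
Qed.

Lemma measurable_fun_rV disp (T : measurableType disp) (f : T -> 'rV[R]_d) :
  (forall j, measurable_fun setT (fun w => f w ord0 j)) ->
  measurable_fun setT f.
Proof.
move=> mf _ A mA; rewrite setTI.
suff : measurable `<=` [set A | measurable (f @^-1` A)] by exact.
apply: sub_g_sigma_preimage => [|j B mB].
  split; rewrite /= ?preimage_set0//.
    by move=> B mB; rewrite setTD preimage_setC; exact: measurableC.
  by move=> B mB; rewrite preimage_bigcup; exact: bigcup_measurable.
by have := mf j measurableT B mB; rewrite setTI.
Qed.

Lemma measurable_orthant (a : 'rV[R]_d) : measurable [set x | le_vec x a].
Proof.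
rewrite (_ : mkset _ = \bigcap_(j in [set: 'I_d])
    ((fun x : 'rV[R]_d => x ord0 j) @^-1` `]-oo, a ord0 j])); last first.
  apply/seteqP; split=> x /= xa j; first by move=> _; rewrite /= in_itv; exact: xa.
  by have := xa j I; rewrite /= in_itv.
apply: fin_bigcap_measurable => // j _.
by rewrite -[X in measurable X]setTI; exact: measurable_coord.
Qed.

(** Why a distribution function determines the law: lower orthants form a
    pi-system, and each strict half-space [x_j < r] is a countable union of
    orthants, so they generate the Borel sigma-algebra. *)
Lemma orthant_measure_unique (m1 m2 : probability 'rV[R]_d R) :
  (forall a, m1 [set x | le_vec x a] = m2 [set x | le_vec x a]) ->
  forall B, measurable B -> m1 B = m2 B.
Proof.
move=> m12 B mB.
pose G := range (fun a : 'rV[R]_d => [set x | le_vec x a]).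
have mG : measurable = <<s G >>.
  apply/seteqP; split; last first.
    apply: smallest_sub; first exact: sigma_algebra_measurable.
    by move=> _ [a _ <-]; exact: measurable_orthant.
  apply: sub_g_sigma_preimage; first exact: smallest_sigma_algebra.
  move=> j A mA.
  suff : measurable_fun setT
      ((fun x : 'rV[R]_d => x ord0 j) : g_sigma_algebraType G -> R).
    by move=> /(_ measurableT A mA); rewrite setTI.
  apply: (measurability _ (RGenInftyO.measurableE R)).
  move=> _ [_ [r ->] <-]; rewrite setTI.
  (* orthants that exhaust the half-space: coordinate j stays below r, the others grow *)
  pose a (k : nat) : 'rV[R]_d :=
    \row_i (if i == j then r - k.+1%:R^-1 else k%:R).
  rewrite (_ : _ @^-1` _ = \bigcup_k [set x : 'rV[R]_d | le_vec x (a k)]).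
    apply: bigcupT_measurable => k; apply: sub_sigma_algebra.
    by exists (a k).
  apply/seteqP; split=> x /=; rewrite in_itv /=; last first.
    move=> [k _ /(_ j)]; rewrite mxE eqxx => /le_lt_trans; apply.
    by rewrite ltrBlDr ltrDl invr_gt0 ltr0n.
  move=> xr.
  pose M := \sum_i `|x ord0 i|.
  have xM i : x ord0 i <= M.
    rewrite /M (bigD1 i)//= (le_trans (ler_norm _))// lerDl.
    by apply: sumr_ge0.
  have /ltr_add_invr[k0 hk0] := xr.
  exists (maxn k0 (Num.truncn M).+1) => // i; rewrite mxE; case: eqP => [->|_].
    rewrite lerBrDr (le_trans _ (ltW hk0))// lerD2l lef_pV2 ?posrE ?ltr0n//.
    by rewrite ler_nat ltnS leq_maxl.
  rewrite (le_trans (xM i))// (le_trans (ltW (truncnS_gt M)))//.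
  by rewrite ler_nat leq_maxr.
apply: (measure_unique G (fun k => [set x | le_vec x (const_mx k%:R)])) => //.
- move=> _ _ [a _ <-] [b _ <-].
  exists (\row_i Num.min (a ord0 i) (b ord0 i)) => //.
  apply/seteqP; split=> x /=.
    by move=> xab; split=> i; move: (xab i); rewrite mxE le_min => /andP[].
  by move=> [xa xb] i; rewrite mxE le_min xa xb.
- by move=> k; exists (const_mx k%:R).
- apply/seteqP; split=> // x _.
  pose M := \sum_i `|x ord0 i|.
  exists (Num.truncn M).+1 => // i; rewrite mxE.
  rewrite (le_trans _ (ltW (truncnS_gt M)))//.
  rewrite /M (bigD1 i)//= (le_trans (ler_norm _))// lerDl.
  by apply: sumr_ge0.
- by move=> _ [a _ <-]; exact: m12.
- by move=> k; rewrite (le_lt_trans (probability_le1 _ _)) ?ltry//; exact: measurable_orthant.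
Qed.

End row_vectors.

(** * Independent copies and the joint law of an i.i.d. family *)

Section product_probability.
Context d (T : measurableType d) (R : realType) (P : probability T R).

Definition tuple_cons n (xt : T * n.-tuple T) : n.+1.-tuple T :=
  [tuple of xt.1 :: xt.2].

Lemma measurable_tuple_cons n : measurable_fun setT (@tuple_cons n).
Proof. exact: measurable_cons. Qed.

HB.instance Definition _ n :=
  isMeasurableFun.Build _ _ _ _ (@tuple_cons n) (@measurable_tuple_cons n).

(** The recursion conses one entry at a time, so that the probability of an event
    of n.+1.-tuples is, by definition of the binary product measure, an integral
    over the first entry of probabilities under the n-fold product. *)
Fixpoint mprod n : probability (n.-tuple T) R :=
  match n with
  | 0 => \d_([tuple] : 0.-tuple T)
  | n'.+1 => distribution (P \x mprod n')%E (@tuple_cons n')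
  end.

Lemma mprod_box n (A : 'I_n -> set T) : (forall i, measurable (A i)) ->
  mprod n (box A) = (\prod_(i < n) P (A i))%E.
Proof.
elim: n A => [|n IH] A mA.
  by rewrite big_ord0 /= diracE mem_set// => -[].
rewrite big_ord_recl -IH; last by move=> i; exact: mA.
rewrite /= /distribution /pushforward.
rewrite (_ : _ @^-1` _ = A ord0 `*` box (fun i => A (lift ord0 i))).
  by rewrite product_measure1E//; exact: measurable_box.
apply/seteqP; split=> -[x t] /=.
  move=> At; split=> [|i]; first exact: At ord0.
  by have := At (lift ord0 i); rewrite tnthS.
by move=> [Ax At] i; case: (unliftP ord0 i) => [j ->|-> //]; rewrite tnthS.
Qed.

End product_probability.

Section joint_law.
Context disp (Om : measurableType disp) d (T : measurableType d) (R : realType).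
Variable P : probability Om R.

Definition joint n (Y : 'I_n -> {RV P >-> T}) (w : Om) : n.-tuple T :=
  [tuple Y i w | i < n].

Lemma measurable_joint n (Y : 'I_n -> {RV P >-> T}) :
  measurable_fun setT (joint Y).
Proof.
apply/measurable_fun_tnthP => i.
rewrite (_ : _ \o _ = Y i); first exact: measurable_funPT.
by apply/funext => w; rewrite /= tnth_mktuple.
Qed.

HB.instance Definition _ n (Y : 'I_n -> {RV P >-> T}) :=
  isMeasurableFun.Build _ _ _ _ (joint Y) (measurable_joint Y).

(** The product rule for finite subfamilies says exactly that the joint law and
    the product measure agree on boxes; the index map s allows the entries to be
    listed in any order. *)
Lemma iid_joint_law (I : eqType) (D : set I) (X : I -> {RV P >-> T})
    (nu : probability T R) n (s : 'I_n -> I) :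
  injective s -> (forall i, D (s i)) -> mutually_independent P D X ->
  (forall i A, measurable A -> P (X (s i) @^-1` A) = nu A) ->
  forall B, measurable B -> P (joint (X \o s) @^-1` B) = mprod nu n B.
Proof.
move=> sI Ds indX Xnu.
apply: (box_measure_unique (m1 := distribution P (joint (X \o s)))).
move=> A mA; rewrite mprod_box//.
(* the sets A, transported to the index type I; setT away from the range of s *)
pose A' k := if [pick i | s i == k] is Some i then A i else setT.
have A's i : A' (s i) = A i.
  by rewrite /A'; case: pickP => [j /eqP/sI -> //|/(_ i)]; rewrite eqxx.
have := indX [seq s i | i <- enum 'I_n] _ _ A'.
rewrite map_inj_uniq// enum_uniq big_map big_enum /= => H.
rewrite /distribution /pushforward (_ : _ @^-1` _ =
  \bigcap_(i in [set` [seq s i | i <- enum 'I_n]]) X i @^-1` A' i).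
  rewrite H//; last 2 first.
    by move=> _ /mapP[i _ ->]; exact: Ds.
    by move=> k; rewrite /A'; case: pickP.
  by apply: eq_bigr => i _; rewrite A's Xnu.
apply/seteqP; split=> w /=.
  move=> Aw _ /= /mapP[i _ ->] /=; rewrite A's.
  by have := Aw i; rewrite tnth_mktuple.
move=> Aw i; rewrite tnth_mktuple.
by have := Aw (s i); rewrite /= A's; apply; apply/map_f; rewrite mem_enum.
Qed.

End joint_law.

Lemma measurable_le_vec disp (T : measurableType disp) (R : realType) d
    (f g : T -> 'rV[R]_d) : measurable_fun setT f -> measurable_fun setT g ->
  measurable [set t | le_vec (f t) (g t)].
Proof.
move=> mf mg; rewrite (_ : mkset _ = \bigcap_(j in [set: 'I_d])
   (setT `&` [set t | f t ord0 j <= g t ord0 j])).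
  apply: fin_bigcap_measurable => // j _.
  apply: measurable_fun_le => //.
    exact: (measurableT_comp (measurable_coord j)).
  exact: (measurableT_comp (measurable_coord j)).
apply/seteqP; split=> t /= H j; first by move=> _; split=> //; exact: H.
by case: (H j).
Qed.

Section independent_copies.
Context disp (Om : measurableType disp) (R : realType) (P : probability Om R).

Lemma mprod_bigcap_coords n (s : seq 'I_n) (A : 'I_n -> set Om) :
  uniq s -> (forall i, measurable (A i)) ->
  mprod P n (\bigcap_(i in [set` s]) ((@tnth n Om)^~ i @^-1` A i)) =
  (\prod_(i <- s) P (A i))%E.
Proof.
move=> us mA.
rewrite (_ : \bigcap_(i in _) _ = box (fun i => if i \in s then A i else setT)).
  rewrite mprod_box; last by move=> i; case: ifP.
  rewrite [RHS]big_uniq//= [RHS]big_mkcond; apply: eq_bigr => i _.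
  by case: ifP => // _; rewrite probability_setT.
apply/seteqP; split=> t /= H i.
  by case: ifPn => // si; exact: H.
by move=> /= si; have := H i; rewrite si.
Qed.

Lemma mprod_coord n (i : 'I_n) (A : set Om) : measurable A ->
  mprod P n ((@tnth n Om)^~ i @^-1` A) = P A.
Proof.
move=> mA; have := @mprod_bigcap_coords n [:: i] (fun=> A) isT (fun=> mA).
rewrite big_seq1 => <-; congr (mprod P n _).
by apply/seteqP; split=> t /= H; [move=> j; rewrite /= inE => /eqP -> |
  by apply: H; rewrite /= inE].
Qed.

Context d (T : measurableType d) (n : nat) (Y : {RV P >-> T}).

(** Copies are numbered from 1 to n.+1, as in the definition of i.i.d. copies;
    the other indices repeat one of them. *)
Definition copy (k : nat) (t : n.+1.-tuple Om) : T := Y (tnth t (inord k.-1)).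

Lemma measurable_copy k : measurable_fun setT (copy k).
Proof.
by apply: measurableT_comp; [exact: measurable_funPT|exact: measurable_tnth].
Qed.

HB.instance Definition _ k :=
  isMeasurableFun.Build _ _ _ _ (copy k) (measurable_copy k).

Definition copies (k : nat) : {RV (mprod P n.+1) >-> T} := copy k.

Lemma copies_law k (A : set T) : measurable A ->
  mprod P n.+1 (copies k @^-1` A) = P (Y @^-1` A).
Proof.
move=> mA; rewrite -(@mprod_coord n.+1 (inord k.-1) (Y @^-1` A))//.
exact: measurable_funPTI.
Qed.

Lemma copies_independent : mutually_independent (mprod P n.+1)
  [set i : nat | (1 <= i <= n.+1)%N] copies.
Proof.
move=> s us sn A mA.
pose o (k : nat) : 'I_n.+1 := inord k.-1.
have oK k : k \in s -> (o k).+1 = k.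
  by move=> /sn /= /andP[k0 kn]; rewrite /o inordK prednK.
have oI : {in s &, injective o}.
  by move=> k l ks ls /(congr1 (fun i : 'I_n.+1 => i.+1)); rewrite !oK.
under eq_bigr do rewrite copies_law//.
transitivity (\prod_(i <- [seq o k | k <- s]) P (Y @^-1` A i.+1))%E; last first.
  by rewrite big_map; apply: eq_big_seq => k ks; rewrite oK.
rewrite -mprod_bigcap_coords ?map_inj_in_uniq//; last first.
  by move=> i; exact: measurable_funPTI.
congr (mprod P n.+1 _); apply/seteqP; split=> t /= H.
  by move=> _ /= /mapP[k ks ->]; rewrite oK//; exact: H.
move=> k /= ks; have := H (o k); rewrite /= oK//; apply.
exact: map_f.
Qed.

End independent_copies.

(** * The record probability as an expectation *)

Section record_formula.
Context (R : realType) (d : nat).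

Lemma measurable_fun_expe disp (T : measurableType disp) (f : T -> \bar R) m :
  measurable_fun setT f -> measurable_fun setT (fun x => f x ^+ m)%E.
Proof.
move=> mf; elim: m => [|m IH]; first exact: measurable_cst.
by under eq_fun do rewrite expeS; exact: emeasurable_funM.
Qed.

(** Condition on the last observation y: the others are independent of it and of
    each other, and each fails to dominate y with the same probability.  The joint
    law is listed with X m.+1 first, because the product measure integrates over
    its first entry. *)
Lemma record_event_integral disp (Om : measurableType disp)
    (P : probability Om R) (nu : probability 'rV[R]_d R) m
    (X : nat -> {RV P >-> 'rV[R]_d}) :
  mutually_independent P [set i : nat | (1 <= i <= m.+1)%N] X ->
  (forall i A, (1 <= i <= m.+1)%N -> measurable A ->
    P (X i @^-1` A) = nu A) ->
  P (record_event m.+1 X) =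
  (\int[nu]_y (nu [set z | ~ le_vec y z]) ^+ m)%E.
Proof.
move=> indX Xnu.
(* entry 0 is the candidate record X m.+1; entry i is X i for 1 <= i <= m *)
pose s (i : 'I_m.+1) : nat := if i == ord0 then m.+1 else i.
have s0 : s ord0 = m.+1 by rewrite /s eqxx.
have sS i : s (lift ord0 i) = i.+1 by rewrite /s.
have ltS (i : 'I_m) : (i.+1 == m.+1) = false by rewrite eqSS ltn_eqF.
have sI : injective s.
  move=> i j; case: (unliftP ord0 i) => [i' ->|->];
    case: (unliftP ord0 j) => [j' ->|->] //; rewrite ?s0 ?sS.
  - by move=> [] /val_inj ->.
  - by move/eqP; rewrite ltS.
  - by move/esym/eqP; rewrite ltS.
have sD i : (1 <= s i <= m.+1)%N.
  by case: (unliftP ord0 i) => [j ->|->]; rewrite ?s0 ?sS //= ltnS ltnW.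
pose E := [set t : m.+1.-tuple 'rV[R]_d |
  forall i : 'I_m, ~ le_vec (tnth t ord0) (tnth t (lift ord0 i))].
have mE : measurable E.
  rewrite (_ : E = \bigcap_(i in [set: 'I_m])
    ~` [set t | le_vec (tnth t ord0) (tnth t (lift ord0 i))]).
    apply: fin_bigcap_measurable => // i _; apply: measurableC.
    by apply: measurable_le_vec; exact: measurable_tnth.
  by apply/seteqP; split=> t /= H i; [move=> _; exact: H|exact: H i I].
have -> : record_event m.+1 X = joint (X \o s) @^-1` E.
  apply/seteqP; split=> w /= H.
    move=> i; rewrite !tnth_mktuple /= s0 sS; apply: H.
    exact: ltn_ord.
  move=> i /andP[i0 im].
  have im' : (i.-1 < m)%N by rewrite prednK.
  have := H (Ordinal im'); rewrite !tnth_mktuple /= s0 sS /=.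
  by rewrite prednK.
rewrite (iid_joint_law (nu := nu) sI sD indX)//; last first.
  by move=> i A mA; exact: Xnu.
rewrite /= /distribution /pushforward; apply: eq_integral => y _ /=.
rewrite (_ : xsection _ _ = box (fun _ : 'I_m => [set z | ~ le_vec y z])).
  rewrite mprod_box; last first.
    move=> _; rewrite -[X in measurable X]/(~` [set z | le_vec y z]).
    by apply/measurableC/measurable_le_vec; [exact: measurable_cst|exact: measurable_id].
  set a := nu _; elim: (m) => [|k IH]; first by rewrite big_ord0.
  by rewrite big_ord_recl IH expeS.
apply/seteqP; split=> t; rewrite xsectionE /=.
  by move=> H i; have := H i; rewrite tnthS.
by move=> H i; rewrite tnthS; exact: H.
Qed.

End record_formula.

Section laws.
Context (R : realType) (d : nat).

(** The bridge from statements about distribution functions to statements about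
    random vectors on arbitrary probability spaces. *)
Lemma df_eq_law disp disp' (T : measurableType disp) (T' : measurableType disp')
    (P : probability T R) (Q : probability T' R)
    (X : {RV P >-> 'rV[R]_d}) (Y : {RV Q >-> 'rV[R]_d}) :
  df P X = df Q Y ->
  forall A, measurable A -> P (X @^-1` A) = Q (Y @^-1` A).
Proof.
move=> XY.
apply: (@orthant_measure_unique R d (distribution P X) (distribution Q Y)) => a.
have := congr1 (fun F => (F a)%:E) XY; rewrite /df /= !fineK//.
- by apply: fin_num_measure; exact: (measurable_funPTI Y (measurable_orthant a)).
- by apply: fin_num_measure; exact: (measurable_funPTI X (measurable_orthant a)).
Qed.

Context disp (T : measurableType disp) (P : probability T R).
Variable X : {RV P >-> 'rV[R]_d}.

Lemma measurable_dominated w : measurable [set v | le_vec (X w) (X v)].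
Proof.
apply: measurable_le_vec; [exact: measurable_cst|exact: measurable_funPT].
Qed.

Lemma H_negE w : (H_neg P X w)%:E = P [set v | le_vec (X w) (X v)].
Proof.
rewrite /H_neg /df (_ : mkset _ = [set v | le_vec (X w) (X v)]).
  by rewrite fineK// fin_num_measure//; exact: measurable_dominated.
by apply/seteqP; split=> v /= H j; have := H j; rewrite !mxE lerN2.
Qed.

Lemma H_neg_ge0 w : 0 <= H_neg P X w.
Proof. by rewrite -lee_fin H_negE. Qed.

Lemma H_neg_le1 w : H_neg P X w <= 1.
Proof.
by rewrite -lee_fin H_negE probability_le1//; exact: measurable_dominated.
Qed.

Lemma measurable_H_neg : measurable_fun setT (H_neg P X).
Proof.
pose E := [set yz : 'rV[R]_d * 'rV[R]_d | le_vec yz.1 yz.2].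
have mE : measurable E by exact: measurable_le_vec.
apply/measurable_EFinP.
rewrite (_ : _ \o _ = (distribution P X \o xsection E) \o X).
  apply: measurableT_comp; last exact: measurable_funPT.
  exact: measurable_fun_xsection.
by apply/funext => w; rewrite /= H_negE xsectionE.
Qed.

Lemma record_event_expectation disp' (T' : measurableType disp')
    (Q : probability T' R) m (Y : nat -> {RV Q >-> 'rV[R]_d}) :
  iid_copies m.+1 Y (df P X) ->
  Q (record_event m.+1 Y) = ('E_P[(fun w => (1 - H_neg P X w) ^+ m)%R])%E.
Proof.
move=> [dfY indY].
rewrite (record_event_integral (nu := distribution P X))//; last first.
  by move=> i A hi mA; exact: df_eq_law (dfY i hi) A mA.
rewrite unlock ge0_integral_distribution//; last 2 first.
- apply: measurable_fun_expe.
  have -> : (fun y => distribution P X [set z | ~ le_vec y z]) =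
      distribution P X \o xsection [set yz | ~ le_vec yz.1 yz.2].
    by apply/funext => y; rewrite /= xsectionE.
  apply: measurable_fun_xsection; apply: measurableC.
  exact: measurable_le_vec.
- by move=> y; exact: expe_ge0.
apply: eq_integral => w _ /=; rewrite EFin_expe EFinB H_negE; congr (_ ^+ m)%E.
rewrite -probability_setC; last exact: measurable_dominated.
by [].
Qed.

Lemma iid_copies_copies m : iid_copies m.+1 (copies m X) (df P X).
Proof.
split; last exact: copies_independent.
move=> i _; apply/funext => a; rewrite /df; congr fine.
exact: (copies_law m X i (measurable_orthant a)).
Qed.

Lemma measurable_cond_record m :
  measurable_fun setT (fun w => (1 - H_neg P X w) ^+ m).
Proof.
apply: measurable_funX; apply: measurable_funB => //.
exact: measurable_H_neg.
Qed.

Lemma cond_record_ge0 m w : 0 <= (1 - H_neg P X w) ^+ m.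
Proof. by rewrite exprn_ge0// subr_ge0 H_neg_le1. Qed.

Lemma cond_record_le1 m w : (1 - H_neg P X w) ^+ m <= 1.
Proof.
by rewrite exprn_ile1// ?subr_ge0 ?H_neg_le1// lerBlDr lerDl H_neg_ge0.
Qed.

Lemma expectation_cond_record_le1 m :
  ('E_P[(fun w => (1 - H_neg P X w) ^+ m)%R] <= 1)%E.
Proof.
rewrite -[leRHS](expectation_cst P); apply: expectation_le => //.
- exact: measurable_cond_record.
- exact: cond_record_ge0.
- by apply: aeW => w; exact: cond_record_le1.
Qed.

(** Given that the last observation is x, a record is set when the m earlier
    ones all fail to dominate x, which has probability (1 - H(-x))^m.  In
    particular the record probability depends on F only through the law of
    H(-X), and the choice operator in its definition ranges over a singleton. *)
Lemma record_prob_expectation m :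
  (record_prob m.+1 (df P X))%:E =
  ('E_P[(fun w => (1 - H_neg P X w) ^+ m)%R])%E.
Proof.
have fE : ('E_P[(fun w => (1 - H_neg P X w) ^+ m)%R])%E \is a fin_num.
  rewrite ge0_fin_numE; last by apply: expectation_ge0; exact: cond_record_ge0.
  by rewrite (le_lt_trans (expectation_cond_record_le1 m)) ?ltry.
rewrite -[RHS]fineK//; congr EFin; apply: xget_unique.
  exists _, _, _, (copies m X); split; first exact: iid_copies_copies.
  by rewrite (record_event_expectation (iid_copies_copies m)).
move=> p [disp' [T' [Q [Y [iidY ->]]]]].
by rewrite (record_event_expectation iidY).
Qed.

End laws.

(** * Monotonicity in the RP ordering *)

Section stochastic_order.
Context (R : realType).

(** The superlevel sets of 1 - (1 - h)^(m+1) are superlevel sets of h; this is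
    what turns stochastic dominance of h into dominance of its transform. *)
Lemma ltr_compl_pow m (h r : R) : 0 <= h <= 1 -> r <= 1 ->
  (r < 1 - (1 - h) ^+ m.+1) = (1 - (1 - r) `^ (m.+1%:R^-1) < h).
Proof.
move=> /andP[h0 h1] r1.
have -> : (r < 1 - (1 - h) ^+ m.+1) = ((1 - h) ^+ m.+1 < 1 - r).
  by apply/idP/idP; lra.
have -> : (1 - (1 - r) `^ (m.+1%:R^-1) < h) = (1 - h < (1 - r) `^ (m.+1%:R^-1)).
  by apply/idP/idP; lra.
rewrite -[in LHS](_ : ((1 - r) `^ (m.+1%:R^-1)) ^+ m.+1 = 1 - r).
  by rewrite ltr_pXn2r// nnegrE ?powR_ge0// subr_ge0.
by rewrite -powR_mulrn ?powR_ge0// -powRrM mulVf ?pnatr_eq0// powRr1 ?subr_ge0.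
Qed.

(** Complementary expectations are added rather than subtracted, which avoids
    integrability side conditions in the extended reals. *)
Lemma expectation_compl disp (T : measurableType disp) (P : probability T R)
    (Z : T -> R) : measurable_fun setT Z -> (forall w, 0 <= Z w <= 1) ->
  ('E_P[Z] + 'E_P[(fun w => 1 - Z w)%R] = 1)%E.
Proof.
move=> mZ Z01; rewrite -[RHS](expectation_cst P) !unlock -ge0_integralD//=.
- by apply: eq_integral => w _; rewrite -EFinD addrC subrK.
- by move=> w _; rewrite lee_fin; have /andP[] := Z01 w.
- exact/measurable_EFinP.
- by move=> w _; rewrite lee_fin subr_ge0; have /andP[] := Z01 w.
- by apply/measurable_EFinP; exact: measurable_funB.
Qed.

(** The expectation of a nonnegative variable is the integral of its tail
    function, which is monotone in the tails. *)
Lemma expectation_stochastic_le disp disp' (T : measurableType disp)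
    (T' : measurableType disp') (P : probability T R) (P' : probability T' R)
    (Z : {RV P >-> R}) (Z' : {RV P' >-> R}) :
  (forall w, 0 <= Z w) -> (forall w, 0 <= Z' w) ->
  (forall r : R, (P [set w | (r < Z w)%R] <= P' [set w | (r < Z' w)%R])%E) ->
  ('E_P[Z] <= 'E_P'[Z'])%E.
Proof.
move=> Z0 Z'0 ZZ'; rewrite !ge0_expectation_ccdf//.
have ccdfE disp0 (S : measurableType disp0) (Q : probability S R)
    (Y : {RV Q >-> R}) r : ccdf Y r = Q [set w | r < Y w].
  by congr (Q _); apply/seteqP; split=> w /=; rewrite in_itv /= andbT.
apply: ge0_le_integral => //=.
- by apply: measurable_funTS; exact: ccdf_measurable.
- by apply: measurable_funTS; exact: ccdf_measurable.
- by move=> r _; rewrite !ccdfE.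
Qed.

Lemma lee_compl_sum (a a' b b' : \bar R) :
  (0 <= a' -> 0 <= b -> 0 <= a -> 0 <= b' ->
   a' <= a -> a + b = 1 -> a' + b' = 1 -> b <= b')%E.
Proof.
case: a a' b b' => [a| |] [a'| |] [b| |] [b'| |] //=.
rewrite -!EFinD !lee_fin => _ _ _ _ aa' [ab] [a'b'].
lra.
Qed.

(** The increasing transform 1 - (1 - H)^m is used instead of the decreasing
    (1 - H)^m, so that only strict upper tails of H occur, as in the definition
    of the RP ordering. *)
Lemma expectation_compl_pow_le m disp disp' (T : measurableType disp)
    (T' : measurableType disp') (P : probability T R) (P' : probability T' R)
    (H : {RV P >-> R}) (H' : {RV P' >-> R}) :
  (forall w, 0 <= H w <= 1) -> (forall w, 0 <= H' w <= 1) ->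
  (forall t : R, (P' [set w | (t < H' w)%R] <= P [set w | (t < H w)%R])%E) ->
  ('E_P[(fun w => (1 - H w) ^+ m)%R] <= 'E_P'[(fun w => (1 - H' w) ^+ m)%R])%E.
Proof.
case: m => [|m] H01 H'01 HH'.
  by rewrite !(expectation_cst _ 1).
have pow01 (h : R) : 0 <= h <= 1 -> 0 <= 1 - (1 - h) ^+ m.+1 <= 1.
  move=> /andP[h0 h1]; rewrite subr_ge0 lerBlDr lerDl exprn_ge0 ?subr_ge0//.
  by rewrite exprn_ile1 ?subr_ge0// lerBlDr lerDl.
have mpow disp0 (S : measurableType disp0) (Q : probability S R)
    (Y : {RV Q >-> R}) : measurable_fun setT (fun w => 1 - (1 - Y w) ^+ m.+1).
  apply: measurable_funB => //; apply: measurable_funX.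
  by apply: measurable_funB => //; exact: measurable_funPT.
have complE disp0 (S : measurableType disp0) (Q : probability S R)
    (Y : {RV Q >-> R}) : (forall w, 0 <= Y w <= 1) ->
    ('E_Q[(fun w => 1 - (1 - Y w) ^+ m.+1)%R] +
      'E_Q[(fun w => (1 - Y w) ^+ m.+1)%R] = 1)%E.
  move=> Y01; rewrite -(expectation_compl Q (mpow _ _ Q Y)).
    congr (_ + expectation _ _)%E; apply/funext => w; rewrite subKr//.
  by move=> w; exact: pow01.
pose Z : {RV P >-> R} := mfun_of (mpow _ _ P H).
pose Z' : {RV P' >-> R} := mfun_of (mpow _ _ P' H').
have le_Z : ('E_P'[Z'] <= 'E_P[Z])%E.
  apply: expectation_stochastic_le.
  - by move=> w; case/andP: (pow01 _ (H'01 w)).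
  - by move=> w; case/andP: (pow01 _ (H01 w)).
  move=> r; have [r1|r1] := leP r 1.
    have E disp0 (S : measurableType disp0) (Y : S -> R) :
        (forall w, 0 <= Y w <= 1) -> [set w | r < 1 - (1 - Y w) ^+ m.+1] =
        [set w | 1 - (1 - r) `^ (m.+1%:R^-1) < Y w].
      move=> Y01; apply/seteqP; split=> w /=; rewrite ltr_compl_pow//.
    by have := HH' (1 - (1 - r) `^ (m.+1%:R^-1)); rewrite -!E.
  rewrite (_ : mkset _ = set0) ?measure0 ?measure_ge0//.
  apply/seteqP; split=> // w /=; apply/negP; rewrite -leNgt ltW//.
  by rewrite (le_lt_trans _ r1)//; case/andP: (pow01 _ (H'01 w)).
apply: (lee_compl_sum _ _ _ _ le_Z (complE _ _ _ _ H01) (complE _ _ _ _ H'01)).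
- by apply: expectation_ge0 => w; case/andP: (pow01 _ (H'01 w)).
- apply: expectation_ge0 => w; rewrite exprn_ge0// subr_ge0.
  by case/andP: (H01 w).
- by apply: expectation_ge0 => w; case/andP: (pow01 _ (H01 w)).
- apply: expectation_ge0 => w; rewrite exprn_ge0// subr_ge0.
  by case/andP: (H'01 w).
Qed.

End stochastic_order.

Section record_prob_monotone.
Context (R : realType) (d m : nat).

(** A larger F in the RP ordering has a stochastically smaller H(-X), hence a
    larger E[(1 - H(-X))^m]. *)
Lemma RP_le_record_prob (F G : 'rV[R]_d -> R) : RP_le F G ->
  record_prob m.+1 F <= record_prob m.+1 G.
Proof.
move=> [? [? [T [T' [P [P' [X [Y [-> -> XY]]]]]]]]].
rewrite -lee_fin !record_prob_expectation.
apply: (@expectation_compl_pow_le R m _ _ _ _ _ _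
  (mfun_of (measurable_H_neg X)) (mfun_of (measurable_H_neg Y))) => // w.
- by rewrite H_neg_ge0 H_neg_le1.
- by rewrite H_neg_ge0 H_neg_le1.
Qed.

Lemma RP_equiv_le (F G : 'rV[R]_d -> R) : RP_equiv F G -> RP_le F G.
Proof.
move=> [? [? [T [T' [P [P' [X [Y [-> -> XY]]]]]]]]].
exists _, _, T, T', P, P', X, Y; split=> // t.
have := XY `]t, +oo[%classic (measurable_itv _).
rewrite (_ : _ @^-1` _ = [set w | t < H_neg P X w]).
  rewrite (_ : _ @^-1` _ = [set w | t < H_neg P' Y w]) => [->//|].
  by apply/seteqP; split=> w /=; rewrite in_itv /= andbT.
by apply/seteqP; split=> w /=; rewrite in_itv /= andbT.
Qed.

Lemma RP_equiv_sym (F G : 'rV[R]_d -> R) : RP_equiv F G -> RP_equiv G F.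
Proof.
move=> [? [? [T [T' [P [P' [X [Y [-> -> XY]]]]]]]]].
by exists _, _, T', T, P', P, Y, X; split=> // B /XY.
Qed.

Lemma RP_equiv_record_prob (F G : 'rV[R]_d -> R) : RP_equiv F G ->
  record_prob m.+1 F = record_prob m.+1 G.
Proof.
move=> FG; apply/eqP; rewrite eq_le; apply/andP; split.
  exact/RP_le_record_prob/RP_equiv_le.
exact/RP_le_record_prob/RP_equiv_le/RP_equiv_sym.
Qed.

End record_prob_monotone.

(** * The class of independent continuous coordinates *)

Section probability_integral_transform.
Context disp (T : measurableType disp) (R : realType) (P : probability T R).

Lemma bigcup_nondecreasing_le (A : nat -> set T) (t : \bar R) :
  (forall k, measurable (A k)) -> {homo A : k l / (k <= l)%N >-> k `<=` l} ->
  (forall k, (P (A k) <= t)%E) -> (P (\bigcup_k A k) <= t)%E.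
Proof.
move=> mA ndA At.
have := nondecreasing_cvg_mu (mu := P) mA (bigcup_measurable (fun k _ => mA k)).
move=> /(_ _)/cvg_lim <-//.
  apply: lime_le; last by apply: nearW => k; exact: At.
  apply: ereal_nondecreasing_is_cvgn => k l kl.
  by apply: le_measure; rewrite ?inE//; exact: ndA.
by move=> k l kl; apply/subsetPset; exact: ndA.
Qed.

Lemma bigcap_nonincreasing_ge (A : nat -> set T) (t : \bar R) :
  (forall k, measurable (A k)) -> {homo A : k l / (k <= l)%N >-> l `<=` k} ->
  (forall k, (t <= P (A k))%E) -> (t <= P (\bigcap_k A k))%E.
Proof.
move=> mA niA At.
have := nonincreasing_cvg_mu (mu := P) _ mA (bigcap_measurable _ (fun k _ => mA k)).
move=> /(_ _ _ _)/cvg_lim <-//.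
- apply: lime_ge; last by apply: nearW => k; exact: At.
  apply: ereal_nonincreasing_is_cvgn => k l kl.
  by apply: le_measure; rewrite ?inE//; exact: niA.
- by rewrite (le_lt_trans (probability_le1 _ _)) ?ltry.
- by move=> k l kl; apply/subsetPset; exact: niA.
Qed.

Variable W : {RV P >-> R}.
Hypothesis W_noatom : forall c, P (W @^-1` [set c]) = 0%E.

Let cdfE x : cdf W x = P [set w | W w <= x].
Proof. by congr (P _); apply/seteqP; split=> w /=; rewrite in_itv. Qed.

Lemma measurable_le_cst (Z : {RV P >-> R}) x : measurable [set w | Z w <= x].
Proof.
by rewrite -[X in measurable X]setTI; apply: measurable_fun_le.
Qed.

(** Probability integral transform: if W has no atom then cdf W (W) is uniform on
    [0, 1].  For 0 <= t < 1 the set [cdf W <= t] is empty, which forces t = 0,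
    or a half-line with a finite supremum c;
    right-continuity gives cdf W c >= t, and the absence of an atom at c gives
    cdf W c <= t, so the half-line is closed and has probability exactly t. *)
Lemma cdf_integral_transform (t : R) :
  P [set w | (cdf W (W w) <= t%:E)%E] = (Num.max 0 (Num.min t 1))%:E.
Proof.
have [t0|t0] := ltP t 0.
  rewrite (_ : mkset _ = set0) ?measure0.
    by rewrite min_l ?max_l// ?ltW// (lt_trans t0).
  apply/seteqP; split=> // w /=; apply/negP; rewrite -ltNge.
  by rewrite (lt_le_trans _ (cdf_ge0 _ _))// lte_fin.
have [t1|t1] := leP 1 t.
  rewrite (_ : mkset _ = setT) ?probability_setT.
    by rewrite max_r// min_r// ler01.
  apply/seteqP; split=> // w _ /=.
  by rewrite (le_trans (cdf_le1 _ _))// lee_fin.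
rewrite max_r//; pose A := [set x : R | (cdf W x <= t%:E)%E].
have [[a Aa]|/forallNP A0] := pselect (exists a, A a); last first.
  have t0' : t = 0.
    apply/eqP; rewrite eq_le t0 andbT -lee_fin.
    have cdf0 : cdf W @ -oo%R --> (0 : R)%:E by exact: cvg_cdfNy0.
    rewrite -(cvg_lim _ cdf0)//; apply: lime_ge; first exact: cvgP cdf0.
    by apply: nearW => x; rewrite ltW// ltNge; apply/negP; exact: A0.
  rewrite (_ : mkset _ = set0) ?measure0; first by rewrite t0'.
  by apply/seteqP; split=> // w /= /A0.
have Adown x y : x <= y -> A y -> A x.
  by move=> xy; apply: le_trans; exact: cdf_nondecreasing.
have [b Ab] : exists b, ubound A b.
  apply: contrapT => /forallNP noub.
  have AT x : A x.
    have /existsNP[y /not_implyP[Ay /negP]] := noub x.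
    by rewrite -ltNge => /ltW xy; exact: Adown Ay.
  suff : 1 <= t by rewrite leNgt t1.
  have cdf1 : cdf W @ +oo%R --> (1 : R)%:E by exact: cvg_cdfy1.
  rewrite -lee_fin -(cvg_lim _ cdf1)//; apply: lime_le; first exact: cvgP cdf1.
  by apply: nearW => x; exact: AT.
pose c := sup A.
have supA : has_sup A by split; [exists a|exists b].
have ltA x : x < c -> A x.
  rewrite -subr_gt0 => /sup_adherent/(_ supA)[y Ay].
  by rewrite -/c opprB addrCA subrr addr0 => /ltW xy; exact: Adown Ay.
have Ale x : A x -> x <= c by exact: sup_upper_bound.
have lt_c : (P [set w | W w < c]%R <= t%:E)%E.
  rewrite (_ : mkset _ = \bigcup_k [set w | W w <= c - k.+1%:R^-1]).
    apply: bigcup_nondecreasing_le => [k|k l kl w /=|k].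
    - exact: measurable_le_cst.
    - by move=> /le_trans; apply; rewrite lerD2l lerN2 lef_pV2 ?posrE ?ltr0n ?ler_nat.
    - rewrite -cdfE; apply: ltA.
      by rewrite ltrBlDr ltrDl invr_gt0 ltr0n.
  apply/seteqP; split=> w /=.
    move=> /ltr_add_invr[k wk]; exists k => //=.
    by rewrite lerBrDr ltW.
  move=> [k _ /= /le_lt_trans]; apply.
  by rewrite ltrBlDr ltrDl invr_gt0 ltr0n.
have le_c : (t%:E <= P [set w | W w <= c]%R)%E.
  rewrite (_ : mkset _ = \bigcap_k [set w | W w <= c + k.+1%:R^-1]).
    apply: bigcap_nonincreasing_ge => [k|k l kl w /=|k].
    - exact: measurable_le_cst.
    - by move=> /le_trans; apply; rewrite lerD2l lef_pV2 ?posrE ?ltr0n ?ler_nat.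
    - rewrite -cdfE ltW// ltNge; apply/negP => /Ale.
      by rewrite leNgt ltrDl invr_gt0 ltr0n.
  apply/seteqP; split=> w /=.
    by move=> wc k _ /=; rewrite (le_trans wc)// lerDl invr_ge0 ler0n.
  move=> wc; rewrite leNgt; apply/negP => /ltr_add_invr[k].
  by rewrite ltNge (wc k I).
have PcE : P [set w | W w <= c] = P [set w | W w < c].
  rewrite (_ : [set w | W w <= c] = [set w | W w < c] `|` W @^-1` [set c]).
    rewrite measureU0//; last exact: W_noatom.
    rewrite (_ : mkset _ = W @^-1` `]-oo, c[); first exact: measurable_funPTI.
    by apply/seteqP; split=> w /=; rewrite in_itv.
  apply/seteqP; split=> w /=; rewrite le_eqVlt.
    by move=> /orP[/eqP|]; [right|left].
  by case=> [->|->]; rewrite ?eqxx ?orbT.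
have -> : [set w | (cdf W (W w) <= t%:E)%E] = [set w | W w <= c].
  apply/seteqP; split=> w /=; first exact: Ale.
  by rewrite le_eqVlt => /orP[/eqP ->|/ltA//]; rewrite cdfE PcE.
by apply/eqP; rewrite eq_le le_c PcE lt_c.
Qed.

End probability_integral_transform.

Section continuous_marginals.
Context disp (T : measurableType disp) (R : realType) (d : nat).
Context (P : probability T R) (X : {RV P >-> 'rV[R]_d}).

Lemma measurable_le_row (a : 'rV[R]_d) : measurable [set w | le_vec (X w) a].
Proof. exact: (measurable_funPTI X (measurable_orthant a)). Qed.

Lemma dfE (a : 'rV[R]_d) : (df P X a)%:E = P [set w | le_vec (X w) a].
Proof. by rewrite /df fineK// fin_num_measure//; exact: measurable_le_row. Qed.

Lemma measurable_coordX j (A : set R) : measurable A ->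
  measurable [set w | A (X w ord0 j)].
Proof.
move=> mA; rewrite -[X in measurable X]setTI.
apply: (measurableT_comp (measurable_coord j) (@measurable_funPT _ _ _ _ X)) => //.
Qed.

(** The event [X_j = c], truncated so that the other coordinates are at most k,
    is contained in a difference of two orthants that are arbitrarily close;
    continuity of the distribution function makes it null, for every k. *)
Lemma continuous_df_noatom j c : continuous (df P X) ->
  P [set w | X w ord0 j = c] = 0%E.
Proof.
move=> cF; pose a (u : R) k : 'rV[R]_d := \row_i (if i == j then u else k%:R).
pose B k := [set w | X w ord0 j = c] `&` [set w | le_vec (X w) (a c k)].
have mB k : measurable (B k).
  apply: measurableI; last exact: measurable_le_row.
  exact: (measurable_coordX j (measurable_set1 c)).
have PB k : (P (B k) <= 0)%E.
  apply/lee_addgt0Pr => e e0; rewrite add0e.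
  have /cvgrPdist_lt/(_ e e0) := cF (a c k).
  move=> /nbhs_ballP[r /= r0 /(_ (a (c - r / 2) k))].
  have near_a : ball (a c k) r (a (c - r / 2) k).
    split=> // i0 i; rewrite !mxE /ball /=; case: eqP => _.
      by rewrite opprB addrC subrK ger0_norm; lra.
    by rewrite subrr normr0.
  move=> /(_ near_a)/= FcF.
  have disj : (P (B k) + (df P X (a (c - r / 2) k))%:E <= (df P X (a c k))%:E)%E.
    rewrite !dfE -measureU//.
    - apply: le_measure; rewrite ?inE//.
      + by apply: measurableU => //; exact: measurable_le_row.
      + exact: measurable_le_row.
      + move=> w [[_]//|wa i]; rewrite (le_trans (wa i))// !mxE.
        by case: eqP => // _; lra.
    - exact: measurable_le_row.
    - apply/seteqP; split=> // w [[/= wc _] /(_ j)].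
      by rewrite mxE eqxx wc; lra.
  rewrite -(@leeD2rE _ (df P X (a (c - r / 2) k))%:E)// (le_trans disj)//.
  rewrite -EFinD lee_fin addrC -lerBlDl ltW//.
  exact: le_lt_trans (ler_norm _) FcF.
have <- : \bigcup_k B k = [set w | X w ord0 j = c].
  apply/seteqP; split=> w; first by move=> [k _ []].
  move=> wc; pose M := \sum_i `|X w ord0 i|.
  exists (Num.truncn M).+1 => //; split=> // i; rewrite mxE.
  case: eqP => [->|_]; first by rewrite wc.
  rewrite (le_trans _ (ltW (truncnS_gt M)))//.
  rewrite /M (bigD1 i)//= (le_trans (ler_norm _))// lerDl.
  by apply: sumr_ge0.
apply/eqP; rewrite -measure_le0; apply: bigcup_nondecreasing_le => // k l kl w.
move=> [wc wk]; split=> // i; rewrite (le_trans (wk i))// !mxE.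
by case: eqP => // _; rewrite ler_nat.
Qed.

End continuous_marginals.

Section independent_coordinates.
Context disp (T : measurableType disp) (R : realType) (d : nat).
Context (P : probability T R) (X : {RV P >-> 'rV[R]_d}).

Lemma measurable_opp_coord j : measurable_fun setT (fun w => - X w ord0 j).
Proof.
apply: measurableT_comp => //.
exact: (measurableT_comp (measurable_coord j)).
Qed.

Definition opp_coord j : {RV P >-> R} := mfun_of (measurable_opp_coord j).

(** The d upper-tail ranks P(X'_j >= X_j), evaluated at X_j itself.  They are
    written through the cdf of the opposite coordinate so that the probability
    integral transform applies. *)
Definition coord_ranks (w : T) : 'rV[R]_d :=
  \row_j fine (cdf (opp_coord j) (opp_coord j w)).

Lemma coord_ranksE w j :
  (coord_ranks w ord0 j)%:E = P [set v | X w ord0 j <= X v ord0 j].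
Proof.
rewrite mxE fineK ?fin_num_measure//.
by congr (P _); apply/seteqP; split=> v /=; rewrite in_itv /= lerN2.
Qed.

Lemma measurable_coord_ranks : measurable_fun setT coord_ranks.
Proof.
apply: measurable_fun_rV => j; under eq_fun do rewrite mxE.
apply: measurableT_comp => //; apply: measurableT_comp => //.
exact: cdf_measurable.
Qed.

HB.instance Definition _ :=
  isMeasurableFun.Build _ _ _ _ coord_ranks measurable_coord_ranks.

Hypothesis indX : mutually_independent P [set: 'I_d] (fun j w => X w ord0 j).

Lemma independent_box (A : 'I_d -> set R) : (forall j, measurable (A j)) ->
  P [set w | forall j, A j (X w ord0 j)] =
  (\prod_(j < d) P [set w | A j (X w ord0 j)])%E.
Proof.
move=> mA; have := indX (enum_uniq 'I_d) (fun _ _ => I) mA.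
rewrite big_enum /= => <-; congr (P _).
apply/seteqP; split=> w /= H j; first by move=> _; exact: H.
by apply: H; rewrite /= mem_enum.
Qed.

Lemma H_neg_prod w : H_neg P X w = \prod_(j < d) coord_ranks w ord0 j.
Proof.
apply: EFin_inj; rewrite H_negE.
pose A j : set R := `[X w ord0 j, +oo[%classic.
rewrite (_ : mkset _ = [set v | forall j, A j (X v ord0 j)]); last first.
  by apply/seteqP; split=> v /= H j; have := H j; rewrite /A /= in_itv /= andbT.
rewrite independent_box; last by move=> j; exact: measurable_itv.
rewrite -prodEFin; apply: eq_bigr => j _; rewrite coord_ranksE.
by congr (P _); apply/seteqP; split=> v; rewrite /A /= in_itv /= andbT.
Qed.

Hypothesis cX : continuous (df P X).

(** The ranks are independent and uniform on [0, 1], whatever the marginals. *)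
Lemma df_coord_ranks a :
  df P coord_ranks a = \prod_(j < d) Num.max 0 (Num.min (a ord0 j) 1).
Proof.
apply: EFin_inj; rewrite dfE -prodEFin.
pose A j := [set x : R | (cdf (opp_coord j) (- x) <= (a ord0 j)%:E)%E].
rewrite (_ : mkset _ = [set w | forall j, A j (X w ord0 j)]).
  rewrite independent_box; last first.
    move=> j; rewrite -[X in measurable X]setTI.
    apply: emeasurable_fun_infty_c => //; apply: measurableT_comp => //.
    exact: cdf_measurable.
  apply: eq_bigr => j _; rewrite -(@cdf_integral_transform _ _ _ P (opp_coord j))//.
  move=> c; rewrite (_ : _ @^-1` _ = [set w | X w ord0 j = - c]).
    exact: continuous_df_noatom.
  apply/seteqP; split=> w; rewrite /opp_coord /mfun_of /= => H.
    by rewrite -H opprK.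
  exact: (etrans (congr1 -%R H) (opprK c)).
apply/seteqP; split=> w /= H j.
  by have := H j; rewrite -lee_fin mxE fineK ?fin_num_measure.
by rewrite -lee_fin mxE fineK ?fin_num_measure//; exact: H.
Qed.

End independent_coordinates.

Section single_class.
Context (R : realType) (d : nat).

(** H(-X) is the product of d independent uniform variables for every member of
    the class, which is why C* is a single RP-equivalence class. *)
Lemma independent_coordinates_RP_equiv (F G : 'rV[R]_d -> R) :
  continuous_df F -> independent_coordinates F ->
  continuous_df G -> independent_coordinates G -> RP_equiv F G.
Proof.
move=> [cF _] [disp [T [P [X [FE indX]]]]] [cG _] [disp' [T' [P' [Y [GE indY]]]]].
exists disp, disp', T, T', P, P', X, Y; split=> // B mB.
rewrite FE in cF; rewrite GE in cG.
pose prd (x : 'rV[R]_d) := \prod_(j < d) x ord0 j.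
have mprd : measurable_fun setT prd.
  by apply: measurable_prod => j _; exact: measurable_coord.
have eq_df : df P (coord_ranks X) = df P' (coord_ranks Y).
  by apply/funext => a; rewrite !df_coord_ranks.
have := df_eq_law (X := coord_ranks X) (Y := coord_ranks Y) eq_df
  (measurable_funPTI (mfun_of mprd) mB).
rewrite (_ : coord_ranks X @^-1` _ = H_neg P X @^-1` B).
  rewrite (_ : coord_ranks Y @^-1` _ = H_neg P' Y @^-1` B) => //.
  by apply/seteqP; split=> w /=; rewrite H_neg_prod.
by apply/seteqP; split=> w /=; rewrite H_neg_prod.
Qed.

Lemma Cstar_record_prob m (F G : 'rV[R]_d -> R) : Cstar F -> Cstar G ->
  record_prob m.+1 F = record_prob m.+1 G.
Proof.
move=> [_ [F' [cF' iF' FF']]] [_ [G' [cG' iG' GG']]].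
rewrite (RP_equiv_record_prob m FF') (RP_equiv_record_prob m GG').
apply: RP_equiv_record_prob.
exact: independent_coordinates_RP_equiv.
Qed.

Lemma record_prob_starE m (F : 'rV[R]_d -> R) : Cstar F ->
  record_prob_star R d m.+1 = record_prob m.+1 F.
Proof.
move=> CF; apply: xget_unique; first by exists F.
by move=> _ [G CG <-]; exact: Cstar_record_prob.
Qed.

End single_class.

(** * The uniform law and Lipschitz marginals *)

Section uniform_law.
Context (R : realType).

Definition unif : probability (measurableTypeR R) R := uniform_prob (@ltr01 R).

Lemma unifE A : measurable A -> unif A = lebesgue_measure (A `&` `[0, 1]).
Proof.
move=> mA; have -> : (unif A = \int[lebesgue_measure]_(x in A) (uniform_pdf 0 1 x)%:E)%E.
  by [].
rewrite integral_uniform_pdf (eq_integral (fun=> 1%E)).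
  by rewrite integral_cst ?mul1e//; exact: measurableI.
by move=> x; rewrite inE /= in_itv /= => -[_ x01]; rewrite /uniform_pdf x01 subr0 invr1.
Qed.

Lemma unif_itv_le (b1 b2 : bool) (a b : R) : a <= b ->
  (unif [set` Interval (BSide b1 a) (BSide b2 b)] <= (b - a)%:E)%E.
Proof.
move=> ab; rewrite unifE//.
apply: (@le_trans _ _ (lebesgue_measure [set` Interval (BSide b1 a) (BSide b2 b)])).
  by apply: le_measure; rewrite ?inE//; exact: measurableI.
rewrite lebesgue_measure_itv /=; case: ifPn => _; first by rewrite EFinB.
by rewrite lee_fin subr_ge0.
Qed.

Lemma unif_set1 c : unif [set c] = 0%E.
Proof.
apply/eqP; rewrite -measure_le0 -set_itv1.
by rewrite (le_trans (unif_itv_le _ _ (lexx c)))// subrr.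
Qed.

Lemma unif_neg : unif `]-oo, 0[%classic = 0%E.
Proof.
rewrite unifE// (_ : _ `&` _ = set0) ?measure0//.
apply/seteqP; split=> // x [] /=; rewrite !in_itv /=; lra.
Qed.

Lemma unif_ge1 : unif `[1, +oo[%classic = 0%E.
Proof.
rewrite unifE// (_ : _ `&` _ = [set 1]) ?lebesgue_measure_set1//.
apply/seteqP; split=> x /=; rewrite !in_itv /=.
  by move=> [x1 x01]; apply/eqP; rewrite eq_le; lra.
by move=> ->; lra.
Qed.

End uniform_law.

(** Union bound in the form used below: the sets S i are mostly null or small
    exceptional sets outside of which A implies B. *)
Lemma probability_cover_le disp (T : measurableType disp) (R : realType)
    (P : probability T R) (I : finType) (A B : set T) (S : I -> set T) :
  measurable A -> measurable B -> (forall i, measurable (S i)) ->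
  (forall w, A w -> B w \/ exists i, S i w) ->
  (P A <= P B + \sum_i P (S i))%E.
Proof.
move=> mA mB mS AB.
pose U := \big[setU/set0]_i S i.
have mU : measurable U by exact: bigsetU_measurable.
have PU : (P U <= \sum_i P (S i))%E.
  suff [] : measurable U /\ (P U <= \sum_i P (S i))%E by [].
  rewrite /U; elim/big_rec2: _ => [|i y U' _ [mU' U'y]]; first by rewrite measure0.
  split; first exact: measurableU.
  by rewrite (le_trans (measureU2 _ _ _))// leeD2l.
rewrite (@le_trans _ _ (P (B `|` U)))//.
  apply: le_measure; rewrite ?inE//; first exact: measurableU.
  move=> w /AB[Bw|[i Sw]]; first by left.
  by right; rewrite /U -bigcup_seq; exists i => //=; rewrite mem_index_enum.
by rewrite (le_trans (measureU2 _ _ _))// leeD2l.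
Qed.

Section lipschitz_marginals.
Context disp (T : measurableType disp) (R : realType) (d : nat).
Context (P : probability T R) (X : {RV P >-> 'rV[R]_d}) (C : R).
Hypothesis C0 : 0 < C.
Hypothesis lipX : forall j (a b : R), a <= b ->
  (P [set w | (a < X w ord0 j <= b)%R] <= (C * (b - a))%:E)%E.

(** Passing from the orthant of x to that of y, some coordinate must cross from
    x_j to y_j. *)
Lemma df_lipschitz (x y : 'rV[R]_d) :
  df P X y - df P X x <= \sum_(j < d) C * `|y ord0 j - x ord0 j|.
Proof.
pose S j := [set w | x ord0 j < X w ord0 j <= y ord0 j].
have mS j : measurable (S j).
  rewrite (_ : S j = [set w | `]x ord0 j, y ord0 j]%classic (X w ord0 j)]).
    exact: (measurable_coordX X j (A := `]x ord0 j, y ord0 j]%classic)).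
  by apply/seteqP; split=> w; rewrite /S /= in_itv.
have PS j : (P (S j) <= (C * `|y ord0 j - x ord0 j|)%:E)%E.
  have [xy|yx] := leP (x ord0 j) (y ord0 j).
    by rewrite ger0_norm ?subr_ge0//; exact: lipX.
  rewrite (_ : S j = set0); first by rewrite measure0 lee_fin mulr_ge0// ltW.
  apply/seteqP; split=> // w /andP[xw wy].
  by have := lt_le_trans xw wy; rewrite ltNge (ltW yx).
rewrite lerBlDl -lee_fin EFinD !dfE -sumEFin.
apply: (@le_trans _ _ (P [set w | le_vec (X w) x] + \sum_j P (S j))%E); last first.
  by rewrite leeD2l//; apply: lee_sum.
apply: probability_cover_le => //; try exact: measurable_le_row.
move=> w /= wy; have [wx|/existsNP[j xj]] := pselect (le_vec (X w) x); first by left.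
right; exists j; rewrite /S /= wy andbT ltNge; exact/negP.
Qed.

Lemma df_continuous : continuous (df P X).
Proof.
move=> x; apply/(@cvgrPdist_le _ _ _ (nbhs x) (nbhs_filter x)) => e e0.
have D0 : 0 < C * d.+1%:R by rewrite mulr_gt0// ltr0n.
apply/nbhs_ballP; exists (e / (C * d.+1%:R)); first by rewrite /= divr_gt0.
move=> y [_ xy].
have bnd (u v : 'rV[R]_d) : (forall j, `|v ord0 j - u ord0 j| <= e / (C * d.+1%:R)) ->
    df P X v - df P X u <= e.
  move=> uv; rewrite (le_trans (df_lipschitz u v))//.
  apply: (@le_trans _ _ (\sum_(j < d) C * (e / (C * d.+1%:R)))).
    by apply: ler_sum => j _; rewrite ler_pM2l.
  rewrite sumr_const card_ord -mulr_natr.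
  have d1 : (d%:R : R) <= d.+1%:R by rewrite ler_nat.
  rewrite [leLHS](_ : _ = e * (d%:R / d.+1%:R)); last first.
    by field; rewrite ?gt_eqF ?ltr0n.
  by rewrite ger_pMr// ler_pdivrMr ?ltr0n// mul1r.
rewrite ler_norml lerNl opprB; apply/andP; split; apply: bnd => j.
  by have /ltW := xy ord0 j; rewrite distrC.
exact/ltW/xy.
Qed.

End lipschitz_marginals.

(** * A path from independence to an antichain *)

Section tilted_family.
Context disp (Om : measurableType disp) (R : realType) (d : nat).
Context (P : probability Om R) (U : {RV P >-> 'rV[R]_d.+2}).
Hypothesis U_unif : forall j (A : set R), measurable A ->
  P [set w | A (U w ord0 j)] = unif R A.
Hypothesis U_indep :
  mutually_independent P [set: 'I_d.+2] (fun j w => U w ord0 j).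

Local Notation j0 := (ord0 : 'I_d.+2).
Local Notation j1 := (lift ord0 ord0 : 'I_d.+2).

(** For U uniform on the cube, the points with U_0 < q are kept, and those with
    U_0 >= q have their second coordinate replaced by -U_0.  The tilted points
    are almost surely pairwise incomparable, since their first two coordinates
    vary in opposite directions.  A tilted point is also almost surely
    incomparable to an untilted one: its first coordinate is at least q, hence
    larger, and its second coordinate is negative, hence smaller. *)
Definition tilt (q : R) (w : Om) : 'rV[R]_d.+2 :=
  \row_j if (j == j1) && (q <= U w ord0 j0) then - U w ord0 j0 else U w ord0 j.

Let mU j : measurable_fun setT (fun w => U w ord0 j).
Proof. exact: (measurableT_comp (measurable_coord j)). Qed.

Lemma measurable_tilt q : measurable_fun setT (tilt q).
Proof.
apply: measurable_fun_rV => j; under eq_fun do rewrite mxE.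
have [_|_] /= := eqVneq j j1; last exact: mU.
apply: measurable_fun_ifT; last exact: mU.
- by apply: measurable_fun_ler => //; exact: mU.
- by apply: measurableT_comp => //; exact: mU.
Qed.

HB.instance Definition _ q :=
  isMeasurableFun.Build _ _ _ _ (tilt q) (measurable_tilt q).

Lemma U_itv b1 b2 j (a b : R) : a <= b ->
  (P [set w | [set` Interval (BSide b1 a) (BSide b2 b)] (U w ord0 j)]
     <= (b - a)%:E)%E.
Proof. by move=> ab; rewrite U_unif//; exact: unif_itv_le. Qed.

Lemma U_continuous : continuous (df P U).
Proof.
apply: (df_continuous (C := 1)) => // j a b ab; rewrite mul1r.
rewrite (_ : mkset _ = [set w | `]a, b]%classic (U w ord0 j)]).
  exact: U_itv.
by apply/seteqP; split=> w /=; rewrite in_itv.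
Qed.

Lemma tilt_continuous q : continuous (df P (tilt q)).
Proof.
apply: (df_continuous (C := 2)) => // j a b ab.
(* the value of a coordinate is either U_j or, when j is the second one, -U_0 *)
pose S : bool -> set Om := fun s =>
  if s then [set w | `]a, b]%classic (U w ord0 j)]
  else [set w | `[(- b), (- a)[%classic (U w ord0 j0)].
rewrite (@le_trans _ _ (P set0 + \sum_s P (S s)))//.
  apply: probability_cover_le => //.
  - rewrite (_ : mkset _ = [set w | `]a, b]%classic (tilt q w ord0 j)]).
      exact: (measurable_coordX (P := P) (tilt q) j (A := `]a, b]%classic)).
    by apply/seteqP; split=> w /=; rewrite in_itv.
  - by case; [exact: (measurable_coordX U j (A := `]a, b]%classic))|
      exact: (measurable_coordX U j0 (A := `[(- b), (- a)[%classic))].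
  move=> w /=; rewrite mxE; case: ifP => _ h; right.
    by exists false; rewrite /S /= in_itv /=; lra.
  by exists true; rewrite /S /= in_itv.
rewrite measure0 add0e big_bool /S.
rewrite (_ : 2 * (b - a) = (b - a) + (- a - - b)); last by ring.
by rewrite EFinD; apply: leeD; apply: U_itv => //; rewrite lerN2.
Qed.

Lemma Cstar_U : Cstar (df P U).
Proof.
have cU : continuous_df (df P U) by split; [exact: U_continuous|exists _, _, P, U].
split=> //; exists (df P U); split=> //; first by exists _, _, P, U.
by exists _, _, _, _, P, P, U, U.
Qed.

Lemma U_set1 j c : P [set w | U w ord0 j = c] = 0%E.
Proof. by rewrite (U_unif j (measurable_set1 c)) unif_set1. Qed.

Lemma U_lt0 j : P [set w | U w ord0 j < 0] = 0%E.
Proof.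
rewrite (_ : mkset _ = [set w | `]-oo, 0[%classic (U w ord0 j)]).
  by rewrite U_unif// unif_neg.
by apply/seteqP; split=> w /=; rewrite in_itv.
Qed.

Lemma U_ge1 j : P [set w | 1 <= U w ord0 j] = 0%E.
Proof.
rewrite (_ : mkset _ = [set w | `[1, +oo[%classic (U w ord0 j)]).
  by rewrite U_unif// unif_ge1.
by apply/seteqP; split=> w /=; rewrite in_itv /= andbT.
Qed.

Let mU_lt0 j : measurable [set w | U w ord0 j < 0].
Proof.
rewrite (_ : mkset _ = [set w | `]-oo, 0[%classic (U w ord0 j)]).
  exact: (measurable_coordX U j (A := `]-oo, 0[%classic)).
by apply/seteqP; split=> w /=; rewrite in_itv.
Qed.

Let mU_eq j c : measurable [set w | U w ord0 j = c].
Proof. exact: (measurable_coordX U j (measurable_set1 c)). Qed.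

(** Tilting only destroys comparabilities: up to null sets, a copy that dominates
    a point after tilting already dominated it before.  The assumption on w
    holds almost surely. *)
Lemma H_neg_tilt_le q w : 0 <= U w ord0 j1 ->
  H_neg P (tilt q) w <= H_neg P U w.
Proof.
move=> w1; rewrite -lee_fin !H_negE.
(* the null events: a tie in coordinate 0, a zero, a negative value *)
pose S (i : 'I_3) := [set v | if i == 0 then U v ord0 j0 = U w ord0 j0 else
  if i == 1 then U v ord0 j0 = 0 else U v ord0 j0 < 0].
have PS i : measurable (S i) /\ P (S i) = 0%E.
  rewrite /S; case: eqP => _; first by split; [exact: mU_eq|exact: U_set1].
  case: eqP => _; first by split; [exact: mU_eq|exact: U_set1].
  by split; [exact: mU_lt0|exact: U_lt0].
have := @probability_cover_le _ _ _ P _ [set v | le_vec (tilt q w) (tilt q v)]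
  [set v | le_vec (U w) (U v)] S.
rewrite big1 ?adde0; last by move=> i _; case: (PS i).
apply.
- exact: measurable_dominated.
- exact: measurable_dominated.
- by move=> i; case: (PS i).
move=> v wv; have := wv j0; have := wv j1.
rewrite !mxE eqxx /=.
have [qw|qw] /= := leP q (U w ord0 j0); have [qv|qv] /= := leP q (U v ord0 j0).
- move=> wv1 wv0; right; exists 0; rewrite /S /=; apply/eqP; rewrite eq_le; lra.
- move=> _ wv0; exfalso; lra.
- move=> wv1 wv0; right.
  have [v0|v0] := ltP (U v ord0 j0) 0; first by exists 2%:R.
  by exists 1; rewrite /S /=; apply/eqP; rewrite eq_le; lra.
- move=> wv1 wv0; left => j; have := wv j; rewrite !mxE.
  by rewrite !(leNgt q) qw qv !andbF.
Qed.

(** Almost sure domination on the same probability space. *)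
Lemma RP_le_tilt q : RP_le (df P U) (df P (tilt q)).
Proof.
exists _, _, _, _, P, P, U, (tilt q); split=> // t.
have mH (X : {RV P >-> 'rV[R]_d.+2}) : measurable [set w | t < H_neg P X w].
  rewrite (_ : mkset _ = mfun_of (measurable_H_neg X) @^-1` `]t, +oo[).
    exact: measurable_funPTI.
  by apply/seteqP; split=> w /=; rewrite in_itv /= andbT.
have := @probability_cover_le _ _ _ P _ [set w | t < H_neg P (tilt q) w]
  [set w | t < H_neg P U w] (fun _ : 'I_1 => [set w | U w ord0 j1 < 0]).
rewrite big1 ?adde0; last by move=> i _; exact: U_lt0.
apply => //.
move=> w /= tH; have [w1|w1] := ltP (U w ord0 j1) 0; first by right; exists 0.
by left; rewrite (lt_le_trans tH)//; exact: H_neg_tilt_le.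
Qed.

Lemma NRPD_tilt q : continuous_df (df P (tilt q)) /\ NRPD (df P (tilt q)).
Proof.
have cT : continuous_df (df P (tilt q)).
  by split; [exact: tilt_continuous|exists _, _, P, (tilt q)].
split=> //; split=> //; exists (df P U).
by split; [exact: Cstar_U|exact: RP_le_tilt].
Qed.

(** For q = 1 only the points of the null event [U_0 >= 1] are tilted. *)
Lemma df_tilt1 : df P (tilt 1) = df P U.
Proof.
apply/funext => a; apply: EFin_inj; rewrite !dfE.
have mge1 : measurable [set w | 1 <= U w ord0 j0].
  rewrite (_ : mkset _ = [set w | `[1, +oo[%classic (U w ord0 j0)]).
    exact: (measurable_coordX U j0 (A := `[1, +oo[%classic)).
  by apply/seteqP; split=> w /=; rewrite in_itv /= andbT.
have tiltE w : U w ord0 j0 < 1 -> tilt 1 w = U w.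
  by move=> w0; apply/rowP => j; rewrite mxE (leNgt 1) w0 andbF.
apply/eqP; rewrite eq_le; apply/andP; split.
- have := @probability_cover_le _ _ _ P _ [set w | le_vec (tilt 1 w) a]
    [set w | le_vec (U w) a] (fun _ : 'I_1 => [set w | 1 <= U w ord0 j0]).
  rewrite big1 ?adde0; last by move=> i _; exact: U_ge1.
  apply => //; try exact: measurable_le_row.
  move=> w /= wa; have [w1|w1] := leP 1 (U w ord0 j0); first by right; exists 0.
  by left; rewrite -tiltE.
- have := @probability_cover_le _ _ _ P _ [set w | le_vec (U w) a]
    [set w | le_vec (tilt 1 w) a] (fun _ : 'I_1 => [set w | 1 <= U w ord0 j0]).
  rewrite big1 ?adde0; last by move=> i _; exact: U_ge1.
  apply => //; try exact: measurable_le_row.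
  move=> w /= wa; have [w1|w1] := leP 1 (U w ord0 j0); first by right; exists 0.
  by left; rewrite tiltE.
Qed.

(** For q = 0 almost every point is tilted, so that almost surely no copy
    dominates and H(-X) = 0. *)
Lemma record_prob_tilt0 m : record_prob m.+1 (df P (tilt 0)) = 1.
Proof.
apply/eqP; rewrite -eqe record_prob_expectation eq_le expectation_cond_record_le1.
rewrite -[leLHS](expectation_cst P); apply: expectation_le => //.
- exact: measurable_cond_record.
- exact: cond_record_ge0.
exists [set w | U w ord0 j0 < 0]; split=> //; first exact: U_lt0.
move=> w /= wH; rewrite ltNge; apply/negP => w0; apply: wH.
rewrite (_ : H_neg P (tilt 0) w = 0) ?subr0 ?expr1n//.
apply: EFin_inj; rewrite H_negE; apply/eqP; rewrite -measure_le0.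
pose S (i : 'I_2) := [set v | if i == 0 then U v ord0 j0 = U w ord0 j0 else
  U v ord0 j0 < 0].
have PS i : measurable (S i) /\ P (S i) = 0%E.
  rewrite /S; case: eqP => _; first by split; [exact: mU_eq|exact: U_set1].
  by split; [exact: mU_lt0|exact: U_lt0].
have := @probability_cover_le _ _ _ P _ [set v | le_vec (tilt 0 w) (tilt 0 v)]
  set0 S.
rewrite measure0 big1 ?adde0; last by move=> i _; case: (PS i).
apply => //.
- exact: measurable_dominated.
- by move=> i; case: (PS i).
move=> v wv; right; have := wv j0; have := wv j1.
rewrite !mxE eqxx /= w0.
have [v0|v0] /= := leP 0 (U v ord0 j0); last by exists 1.
by move=> wv1 wv0; exists 0; rewrite /S /=; apply/eqP; rewrite eq_le; lra.
Qed.

End tilted_family.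

Section coupling.
Context disp (Om : measurableType disp) (R : realType) (d : nat).
Variable P : probability Om R.

Lemma measurable_record_event disp' (T : measurableType disp')
    (Q : probability T R) n (X : nat -> {RV Q >-> 'rV[R]_d}) :
  measurable (record_event n X).
Proof.
rewrite (_ : record_event n X = \bigcap_(i in [set: 'I_n])
    if (1 <= i)%N then ~` [set w | le_vec (X n w) (X i w)] else setT).
  apply: fin_bigcap_measurable => // i _; case: ifP => // _.
  by apply/measurableC/measurable_le_vec; exact: measurable_funPT.
apply/seteqP; split=> w H.
  by move=> i _; case: ifP => // i1; apply: H; rewrite i1 ltn_ord.
by move=> i /andP[i1 ltin]; have := H (Ordinal ltin) I; rewrite /= i1.
Qed.

Lemma record_prob_copies m (X : {RV P >-> 'rV[R]_d}) :
  (record_prob m.+1 (df P X))%:E =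
  mprod P m.+1 (record_event m.+1 (copies m X)).
Proof.
by rewrite record_prob_expectation (record_event_expectation (iid_copies_copies X m)).
Qed.

(** When X and Y are coupled so as to differ only on S, the two record events
    differ only if some of the m.+1 independent copies falls in S. *)
Lemma record_prob_coupling m (X Y : {RV P >-> 'rV[R]_d}) (S : set Om) (p : R) :
  measurable S -> (forall w, ~ S w -> X w = Y w) -> (P S <= p%:E)%E ->
  record_prob m.+1 (df P X) <= record_prob m.+1 (df P Y) + m.+1%:R * p.
Proof.
move=> mS XY PS; rewrite -lee_fin EFinD !record_prob_copies.
pose D (i : 'I_m.+1) : set (m.+1.-tuple Om) := (@tnth m.+1 Om)^~ i @^-1` S.
rewrite (@le_trans _ _ (mprod P m.+1 (record_event m.+1 (copies m Y)) +
    \sum_i mprod P m.+1 (D i))%E)//.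
  apply: probability_cover_le.
  - exact: (measurable_record_event m.+1 (copies m X)).
  - exact: (measurable_record_event m.+1 (copies m Y)).
  - by move=> i; rewrite -[X in measurable X]setTI; exact: measurable_tnth.
  move=> t Xt; have [|noD] := pselect (exists i, D i t); first by right.
  left=> i hi; have := Xt i hi.
  have copyE k : copies m X k t = copies m Y k t.
    by apply: XY => Sk; apply: noD; exists (inord k.-1).
  by rewrite !copyE.
rewrite leeD2l//.
apply: (@le_trans _ _ (\sum_(i < m.+1) p%:E)%E).
  by apply: lee_sum => i _; rewrite /D mprod_coord.
by rewrite sumEFin sumr_const card_ord mulr_natl.
Qed.

End coupling.

Section tilted_path.
Context disp (Om : measurableType disp) (R : realType) (d : nat).
Context (P : probability Om R) (U : {RV P >-> 'rV[R]_d.+2}).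
Hypothesis U_unif : forall j (A : set R), measurable A ->
  P [set w | A (U w ord0 j)] = unif R A.

Lemma tilt_eq_off (q q' : R) w : q <= q' ->
  ~ `[q, q'[%classic (U w ord0 ord0) -> tilt U q w = tilt U q' w.
Proof.
move=> qq' /=; rewrite in_itv /= => /negP.
rewrite negb_and -leNgt -ltNge => out; apply/rowP => j; rewrite !mxE.
suff -> : (q <= U w ord0 ord0) = (q' <= U w ord0 ord0) by [].
by case/orP: out => h; apply/idP/idP; lra.
Qed.

(** Tilting at q and at q' gives the same vector unless U_0 lies between q and q'. *)
Lemma record_prob_tilt_lipschitz m (q q' : R) :
  record_prob m.+1 (df P (tilt U q)) <=
  record_prob m.+1 (df P (tilt U q')) + m.+1%:R * `|q - q'|.
Proof.
pose a := Num.min q q'; pose b := Num.max q q'.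
have ab : a <= b by rewrite ge_min le_max lexx.
have -> : `|q - q'| = b - a.
  rewrite /a /b; case: (leP q q') => qq'.
    by rewrite ler0_norm ?opprB// subr_le0.
  by rewrite gtr0_norm// subr_gt0.
apply: (@record_prob_coupling _ _ _ _ _ _ _ _
  [set w | `[a, b[%classic (U w ord0 ord0)]).
- exact: (measurable_coordX U ord0 (A := `[a, b[%classic)).
- rewrite /a /b; case: (leP q q') => qq' w Uw; first exact: tilt_eq_off.
  by apply/esym/tilt_eq_off => //; exact: ltW.
- exact: U_itv.
Qed.

Lemma record_prob_tilt_continuous m :
  continuous (fun q => record_prob m.+1 (df P (tilt U q))).
Proof.
move=> q; apply/cvgrPdist_le => e e0.
apply/nbhs_ballP; exists (e / m.+1%:R); first by rewrite /= divr_gt0.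
move=> q' /= qq'.
have bnd : m.+1%:R * `|q - q'| <= e.
  by rewrite mulrC -ler_pdivlMr ?ltr0n// ltW.
have := record_prob_tilt_lipschitz m q q'.
have := record_prob_tilt_lipschitz m q' q.
rewrite (distrC q' q) ler_norml; lra.
Qed.

Hypothesis U_indep :
  mutually_independent P [set: 'I_d.+2] (fun j w => U w ord0 j).

(** Intermediate values along the path, which runs from record probability 1 at
    q = 0 to the independent case at q = 1. *)
Lemma record_prob_tilt_onto m (p : R) :
  record_prob_star R d.+2 m.+1 <= p <= 1 ->
  exists2 F : 'rV[R]_d.+2 -> R, continuous_df F /\ NRPD F &
    record_prob m.+1 F = p.
Proof.
move=> /andP[p_ge p_le].
pose f q := record_prob m.+1 (df P (tilt U q)).
have f0 : f 0 = 1 by exact: record_prob_tilt0.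
have f1 : f 1 = record_prob_star R d.+2 m.+1.
  by rewrite /f (df_tilt1 U_unif) (record_prob_starE m (Cstar_U U_unif U_indep)).
have [||q _ fq] := IVT (f := f) (v := p) ler01.
- exact/continuous_subspaceT/record_prob_tilt_continuous.
- by rewrite f0 f1 min_r ?max_l ?p_ge ?(le_trans p_ge).
- by exists (df P (tilt U q)) => //; exact: NRPD_tilt.
Qed.

End tilted_path.

(** * The range of the record probability *)

Unset Implicit Arguments.

Theorem theorem1p11 (R : realType) (d n : nat) (hd : (2 <= d)%N) (hn : (1 <= n)%N) :
  [set record_prob n F | F in [set F : 'rV[R]_d -> R | continuous_df F /\ NRPD F]]
  = `[record_prob_star R d n, 1]%classic.
Proof.
case: d hd => [|[|d]] // _; case: n hn => // m _.
apply/seteqP; split=> [_ [F [cF [_ [Fs [CFs FsF]]]] <-]|p].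
  rewrite /= in_itv /= (record_prob_starE m CFs) RP_le_record_prob//=.
  have [_ [disp [T [P [X ->]]]]] := cF.
  by rewrite -lee_fin record_prob_expectation expectation_cond_record_le1.
rewrite /= in_itv /= => p01.
pose P := mprod (unif R) d.+2.
pose u (w : d.+2.-tuple (measurableTypeR R)) : 'rV[R]_d.+2 := \row_j tnth w j.
have mu : measurable_fun setT u.
  apply: measurable_fun_rV => j; under eq_fun do rewrite mxE.
  exact: measurable_tnth.
pose U : {RV P >-> 'rV[R]_d.+2} := mfun_of mu.
have U_unif j (A : set R) : measurable A -> P [set w | A (U w ord0 j)] = unif R A.
  move=> mA; rewrite -(mprod_coord (unif R) j mA); congr (P _).
  by apply/seteqP; split=> w; rewrite /= mxE.
have U_indep : mutually_independent P [set: 'I_d.+2] (fun j w => U w ord0 j).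
  move=> s us _ A mA; under eq_bigr do rewrite U_unif//.
  rewrite -(mprod_bigcap_coords (unif R) us mA); congr (P _).
  by apply/seteqP; split=> w H j /H; rewrite /= mxE.
exact: record_prob_tilt_onto U_unif U_indep m p p01.
Qed.
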